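(* Let $\mathcal{F}=(G,I,O,F,\lambda,\alpha)$ be an XY-fusion network with XY-flow $(p,<)$. Then the XY-fusion pattern defined by $$\Bigl(\prod_{i}^{<} X^{k_i}_{g(i)}\,Z^{k_i}_{\mathrm{Odd}(g(i))}\,M_i^{\lambda_i,\alpha_i,k_i}\Bigr)\Bigl(\prod_{f=(i,j)\in F}X^{k_f}_{g(f)}\,Z^{k_f}_{\mathrm{Odd}(g(f))}\,F_{ij}^{\lambda(f),s_f,k_f}\Bigr)E_G\,N_{\overline{I}},$$ where $g(i)=p(i)\cap\{j : i<j\}$, $\prod^{<}$ denotes concatenation in the order $<$ and $\prod$ denotes concatenation in any order, is uniformly, strongly and stepwise deterministic on success, and implements the target linear map $T(\mathcal{F})$ when all fusions are successful.
   Context: Open graph $(G,I,O)$: an undirected graph $G=(V,E)$ with $I,O\subseteq V$ (inputs, outputs); $\overline O=V\setminus O$, $\overline I=V\setminus I$. A labelled open graph also has labels $\lambda:\overline O\to\{\mathrm{XY},\mathrm{XZ},\mathrm{YZ},X,Y,Z\}$ and angles $\alpha:\overline O\to[0,2\pi)$ (irrelevant for Pauli labels). Measurement bases $\{|+_{\lambda,\alpha}\rangle,|-_{\lambda,\alpha}\rangle\}$: $\frac1{\sqrt2}(|0\rangle\pm e^{i\alpha}|1\rangle)$ for XY, $\frac1{\sqrt2}(|+\rangle\pm e^{i\alpha}|-\rangle)$ for YZ, $\frac1{\sqrt2}(|i\rangle\pm e^{i\alpha}|{-i}\rangle)$ for XZ, and the Pauli eigenbasis for labels $X,Y,Z$.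 The target linear map of a labelled open graph is $T=\bigl(\prod_{i\in\overline O}\langle+_{\lambda(i),\alpha(i)}|_i\bigr)E_GN_{\overline I}$, where $N_{\overline I}$ prepares each $i\in\overline I$ in $|+\rangle$ and $E_G$ applies $CZ$ along each edge. XY-fusion network $\mathcal{F}=(G,I,O,F,\lambda,\alpha)$: an open graph $(G,I,O)$, a multiset $F$ of pairs of vertices of $\overline O$ (fusions), labels $\lambda:\overline O\to\{\mathrm{XY},\mathrm{XZ},\mathrm{YZ},X,Y,Z\}$ and $\lambda:F\to\{X,Y\}$, and angles $\alpha:\overline O\to[0,2\pi)$. Its target open graph $\mathcal{M}_\mathcal{F}$ is obtained from $G$ by adding for each $f=(a,b)\in F$ a new vertex (also denoted $f$) adjacent to $a$ and $b$, with label $\lambda(f)$; $I,O$ and the other labels and angles are unchanged. $T(\mathcal{F}):=T(\mathcal{M}_\mathcal{F})$. $\mathrm{Odd}(K)$ is the set of vertices with an odd number of neighbours in $K$ (here in $\mathcal{M}_\mathcal{F}$). A Pauli flow on a labelled open graph is a map $p:\overline O\to\mathcal{P}(\overline I)$ and a strict partial order $<$ on the vertices such that for all $v\in\overline O$: (1) for all $w\in p(v)$, if $\lambda(w)\notin\{X,Y\}$ and $v\neq w$ then $v<w$; (2) for all $w\in\mathrm{Odd}(p(v))$, if $\lambda(w)\notin\{Y,Z\}$ and $v\neq w$ then $v<w$; (3) for all $w\le v$, if $\lambda(w)=Y$ and $v\neq w$ then ($w\in p(v)\Leftrightarrow w\in\mathrm{Odd}(p(v))$); (4) $\lambda(v)=\mathrm{XY}\Rightarrow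 v\notin p(v)$ and $v\in\mathrm{Odd}(p(v))$; (5) $\lambda(v)=\mathrm{XZ}\Rightarrow v\in p(v)$ and $v\in\mathrm{Odd}(p(v))$; (6) $\lambda(v)=\mathrm{YZ}\Rightarrow v\in p(v)$ and $v\notin\mathrm{Odd}(p(v))$; (7) $\lambda(v)=X\Rightarrow v\in\mathrm{Odd}(p(v))$; (8) $\lambda(v)=Z\Rightarrow v\in p(v)$; (9) $\lambda(v)=Y\Rightarrow$ exactly one of $v\in p(v)$, $v\in\mathrm{Odd}(p(v))$ holds. (In (1) and (2) the label condition counts as satisfied for $w\in O$.) XY-flow for $\mathcal{F}$: a Pauli flow $(p,<)$ on $\mathcal{M}_\mathcal{F}$ such that no corrections need to be applied on fusion vertices; concretely, for every fusion vertex $f$ with $\lambda(f)=X$ and every measured vertex $v\neq f$ of $\mathcal{M}_\mathcal{F}$, $f\notin\mathrm{Odd}(p(v))$. XY-fusion pattern: a qubit register $V$ with $I,O\subseteq V$ and a sequence of commands (executed from right to left): preparations $N_i$ of $|+\rangle$; $E_{ij}$ ($CZ$); fusions $F_{ij}^{\lambda,s,k}$, $\lambda\in\{X,Y\}$, with success outcome $s$ and measurement outcome $k$; destructive measurements $M_i^{\lambda,\alpha,k}$ with outcome $k=0$ for $|+_{\lambda,\alpha}\rangle$ and $k=1$ for $|-_{\lambda,\alpha}\rangle$; Pauli corrections $X^{k}_S$, $Z^{k}_S$ (apply $X$, resp. $Z$, to the qubits of $S$ if $k=1$), $k$ a linear combination of measurement outcomes. Each node is implemented by several GHZ-entangled photons,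 so that a fusion leaves the nodes $i,j$ available; a successful fusion with outcome $k$ has the effect of adding a node $f$ joined by $CZ$ to $i$ and $j$ and measured in the Pauli basis $\lambda$ with outcome $k$. The success branches are the linear maps obtained by fixing all outcomes with every fusion successful. The pattern is deterministic on success if all success branches are proportional (implement the same linear map); strongly so if they are equal up to a global phase; uniformly so if this holds for all choices of measurement angles; stepwise so if each subpattern obtained by truncating after a measurement command and adding back all corrections depending on that measured qubit is deterministic on success.
   Formalization: Repaired: corrections for i are X on p(i) and Z on Odd(p(i)), cut to qubits later in execution, not g(i), Odd(g(i)); fusion corrections follow all fusions; XY-flow also asks, for Y-fusions f, that f∈p(v) iff f∈Odd(p(v)); in flow condition (3) w≤v means not v<w. *)

(* Defs.v *)
From mathcomp Require Import all_boot all_order all_algebra.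
From mathcomp Require Import reals trigo.
From mathcomp Require Import complex.

Set Implicit Arguments.
Unset Strict Implicit.
Unset Printing Implicit Defensive.

Import Order.TTheory GRing.Theory Num.Theory.
Local Open Scope ring_scope.
Local Open Scope complex_scope.

Inductive mlabel := XY | XZ | YZ | PX | PY | PZ.

Definition is_PX (l : mlabel) : bool := if l is PX then true else false.
Definition is_PY (l : mlabel) : bool := if l is PY then true else false.
Definition is_PZ (l : mlabel) : bool := if l is PZ then true else false.

(* Labels and angles live on the non-outputs; the total functions [lg_label]
   and [lg_angle] carry irrelevant values on [lg_out]. *)
Record labelled_graph (R : realType) (W : finType) := LabelledGraph {
  lg_adj : rel W;
  lg_in : {set W};
  lg_out : {set W};
  lg_label : W -> mlabel;
  lg_angle : W -> R }.

Definition odd_nbhd (W : finType) (e : rel W) (K : {set W}) : {set W} :=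
  [set w | odd #|[set u in K | e w u]|].

(* Each undirected edge is listed once, for a symmetric irreflexive [e]. *)
Definition edges (W : finType) (e : rel W) : seq (W * W) :=
  [seq uv <- enum {: W * W} |
     e uv.1 uv.2 && (enum_rank uv.1 < enum_rank uv.2)%N].

(* A pure state of the qubits in [A], a subset of [W], is represented by its
   amplitude function on [{0,1}^W], which must not depend on the coordinates
   outside [A] (predicate [state_on]).  Tensoring with a fresh qubit [i] then
   multiplies by the amplitude of that qubit, and applying a bra to [i] sums
   over the coordinate [i], on which the result no longer depends. *)

Definition state (R : realType) (W : finType) := {ffun {ffun W -> bool} -> R[i]}.

Section Operations.
Variables (R : realType) (W : finType).
Implicit Types (psi : state R W) (x : {ffun W -> bool}) (v : bool -> R[i]).

Definition state_on (A : {set W}) psi : Prop :=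
  forall x y : {ffun W -> bool}, {in A, x =1 y} -> psi x = psi y.

Definition ket (i : W) v psi : state R W :=
  [ffun x : {ffun W -> bool} => v (x i) * psi x].

Definition bra (i : W) v psi : state R W :=
  [ffun x : {ffun W -> bool} => \sum_(b : bool)
     (v b)^* * psi [ffun j => if j == i then b else x j]].

Definition cz (i j : W) psi : state R W :=
  [ffun x : {ffun W -> bool} => (-1) ^+ (x i && x j) * psi x].

Definition pauliX (S : {set W}) psi : state R W :=
  [ffun x : {ffun W -> bool} => psi [ffun j => x j (+) (j \in S)]].

Definition pauliZ (S : {set W}) psi : state R W :=
  [ffun x : {ffun W -> bool} => (-1) ^+ #|[set j in S | x j]| * psi x].

End Operations.

Section Bases.
Variable R : realType.

Definition rsqrt2 : R[i] := ((Num.sqrt 2)^-1)%:C.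
Definition expi (a : R) : R[i] := cos a +i* sin a.

(* [ket_x k], [ket_y k], [ket_z k] are the eigenvectors for (-1)^k. *)
Definition ket_x (k b : bool) : R[i] := rsqrt2 * (if b then (-1) ^+ k else 1).
Definition ket_y (k b : bool) : R[i] :=
  rsqrt2 * (if b then (-1) ^+ k * 'i else 1).
Definition ket_z (k b : bool) : R[i] := (b == k)%:R.

Definition basis (l : mlabel) (a : R) (k b : bool) : R[i] :=
  match l with
  | XY => rsqrt2 * (ket_z false b + (-1) ^+ k * expi a * ket_z true b)
  | YZ => rsqrt2 * (ket_x false b + (-1) ^+ k * expi a * ket_x true b)
  | XZ => rsqrt2 * (ket_y false b + (-1) ^+ k * expi a * ket_y true b)
  | PX => ket_x k b
  | PY => ket_y k b
  | PZ => ket_z k b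
  end.

Definition target_map (W : finType) (M : labelled_graph R W) (psi : state R W) :
    state R W :=
  foldr (fun i => bra i (basis (lg_label M i) (lg_angle M i) false))
    (foldr (fun uv => cz uv.1 uv.2)
       (foldr (fun i => ket i (ket_x false)) psi (enum (~: lg_in M)))
       (edges (lg_adj M)))
    (enum (~: lg_out M)).

End Bases.

Section PauliFlow.
Variables (R : realType) (W : finType) (M : labelled_graph R W).
Variables (p : W -> {set W}) (lt : rel W).

Let lam := lg_label M.
Let out := lg_out M.
Let Odd := odd_nbhd (lg_adj M).

(* In [pf_3], "w <= v" means "not v < w", as is usual for Pauli flow: with a
   partial order, an incomparable Y-measured [w] would otherwise be neither
   constrained here nor corrected. *)
Record pauli_flow : Prop := PauliFlow {
  pf_irr : irreflexive lt;
  pf_trans : transitive lt;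
  pf_codom : forall v, v \notin out -> p v \subset ~: lg_in M;
  pf_1 : forall v w, v \notin out -> w \in p v ->
    (w \in out) || ~~ (is_PX (lam w) || is_PY (lam w)) -> v != w -> lt v w;
  pf_2 : forall v w, v \notin out -> w \in Odd (p v) ->
    (w \in out) || ~~ (is_PY (lam w) || is_PZ (lam w)) -> v != w -> lt v w;
  pf_3 : forall v w, v \notin out -> w \notin out -> ~~ lt v w ->
    lam w = PY -> v != w -> (w \in p v) = (w \in Odd (p v));
  pf_4 : forall v, v \notin out -> lam v = XY ->
    v \notin p v /\ v \in Odd (p v);
  pf_5 : forall v, v \notin out -> lam v = XZ -> v \in p v /\ v \in Odd (p v);
  pf_6 : forall v, v \notin out -> lam v = YZ ->
    v \in p v /\ v \notin Odd (p v);
  pf_7 : forall v, v \notin out -> lam v = PX -> v \in Odd (p v);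
  pf_8 : forall v, v \notin out -> lam v = PZ -> v \in p v;
  pf_9 : forall v, v \notin out -> lam v = PY ->
    (v \in p v) (+) (v \in Odd (p v)) }.

End PauliFlow.

Inductive flabel := FX | FY.

Definition mlabel_of_flabel (l : flabel) : mlabel :=
  match l with FX => PX | FY => PY end.

Definition angle_choice (R : realType) (W : finType) (A : {set W})
    (a : W -> R) : Prop :=
  forall i, i \in A -> 0 <= a i /\ a i < 2 * pi.

(* The multiset of fusions is a family of pairs indexed by [F]. *)
Record fusion_network (R : realType) (V F : finType) := FusionNetwork {
  fn_adj : rel V;
  fn_in : {set V};
  fn_out : {set V};
  fn_ends : F -> V * V;
  fn_label : V -> mlabel;
  fn_flabel : F -> flabel;
  fn_angle : V -> R;
  fn_sym : symmetric fn_adj;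
  fn_irr : irreflexive fn_adj;
  fn_ends_measured : forall f,
    (fn_ends f).1 \notin fn_out /\ (fn_ends f).2 \notin fn_out;
  fn_angle_range : angle_choice (~: fn_out) fn_angle }.

Section Network.
Variables (R : realType) (V F : finType) (N : fusion_network R V F).

Definition is_end (f : F) (v : V) : bool :=
  v \in [set (fn_ends N f).1; (fn_ends N f).2].

Definition target_adj : rel (V + F) := fun u w =>
  match u, w with
  | inl a, inl b => fn_adj N a b
  | inl a, inr f => is_end f a
  | inr f, inl a => is_end f a
  | inr _, inr _ => false
  end.

Definition target_graph : labelled_graph R (V + F)%type := {|
  lg_adj := target_adj;
  lg_in := inl @: fn_in N;
  lg_out := inl @: fn_out N;
  lg_label := fun u =>
    match u with
    | inl v => fn_label N v
    | inr f => mlabel_of_flabel (fn_flabel N f)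
    end;
  lg_angle := fun u => match u with inl v => fn_angle N v | inr _ => 0 end |}.

Variables (p : V + F -> {set V + F}) (lt : rel (V + F)).

(* The correction that the outcome at [v] requires on a vertex [f] is
   X^[f in p v] Z^[f in Odd (p v)].  It need not be applied exactly when it
   preserves the measurement basis of [f]: for an X-fusion when the Z part is
   absent, for a Y-fusion when the X and Z parts are both present or both
   absent.  The second case is [pf_3] for fusions performed before [v]. *)
Record xy_flow : Prop := XYFlow {
  xy_pauli : pauli_flow target_graph p lt;
  xy_fusionX : forall f v, fn_flabel N f = FX ->
    v \notin lg_out target_graph -> v != inr f ->
    inr f \notin odd_nbhd target_adj (p v);
  xy_fusionY : forall f v, fn_flabel N f = FY ->
    v \notin lg_out target_graph -> v != inr f ->
    (inr f \in p v) = (inr f \in odd_nbhd target_adj (p v)) }.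

End Network.

(* [V] is the register and [K] the set of names of measurement outcomes.  A
   linear combination of outcomes over F_2 is a subset of [K].  The success
   outcome of a fusion has no name, as no command of the patterns considered
   depends on it and only success branches are given a meaning. *)

Inductive command (R : realType) (V K : finType) :=
  | Prepare of V
  | Entangle of V & V
  | Fuse of V & V & flabel & K
  | Measure of V & mlabel & R & K
  | CorrectX of {set V} & {set K}
  | CorrectZ of {set V} & {set K}.

Arguments Prepare {R V K}.
Arguments Entangle {R V K}.
Arguments Fuse {R V K}.
Arguments Measure {R V K}.
Arguments CorrectX {R V K}.
Arguments CorrectZ {R V K}.

(* Commands are listed as written on paper: the last one is executed first. *)
Definition pattern (R : realType) (V K : finType) := seq (command R V K).

Section Patterns.
Variables (R : realType) (V K : finType).
Implicit Types (P : pattern R V K) (k : K -> bool) (psi : state R V).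

Definition signal k (s : {set K}) : bool := odd #|[set a in s | k a]|.

(* A successful fusion: a new qubit, with basis states indexed by [b], is
   prepared in |+>, joined by CZ to [i] and [j], and projected on the outcome
   [o] of the measurement in the basis [l]. *)
Definition fuse (i j : V) (l : flabel) (o : bool) psi : state R V :=
  [ffun x : {ffun V -> bool} => \sum_(b : bool)
     (basis (mlabel_of_flabel l) 0 o b)^* *
     ((\prod_(u in [set i; j]) (-1) ^+ (b && x u)) *
      (ket_x R false b * psi x))].

Definition run_command k (c : command R V K) psi : state R V :=
  match c with
  | Prepare i => ket i (@ket_x R false) psi
  | Entangle i j => cz i j psi
  | Fuse i j l a => fuse i j l (k a) psi
  | Measure i l al a => bra i (basis l al (k a)) psi
  | CorrectX A s => if signal k s then pauliX A psi else psi
  | CorrectZ A s => if signal k s then pauliZ A psi else psi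
  end.

Definition success_branch P k psi : state R V := foldr (run_command k) psi P.

Definition with_angles (a : V -> R) P : pattern R V K :=
  [seq (if c is Measure i l _ n then Measure i l (a i) n else c) | c <- P].

Definition correction_on (n : K) (c : command R V K) : bool :=
  match c with
  | CorrectX _ s | CorrectZ _ s => n \in s
  | _ => false
  end.

Variable inp : {set V}.

Definition deterministic P : Prop := forall k k', exists2 c : R[i], c != 0 &
  forall psi, state_on inp psi ->
  forall x, success_branch P k psi x = c * success_branch P k' psi x.

Definition strongly_deterministic P : Prop :=
  forall k k', exists2 c : R[i], `|c| = 1 :> R[i] &
  forall psi, state_on inp psi ->
  forall x, success_branch P k psi x = c * success_branch P k' psi x.

Definition stepwise_deterministic P : Prop :=
  forall P2 i l a n P1, P = P2 ++ Measure i l a n :: P1 ->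
  deterministic (filter (correction_on n) P2 ++ Measure i l a n :: P1).

Definition uniformly (A : {set V}) (D : pattern R V K -> Prop) P : Prop :=
  forall a, angle_choice A a -> D (with_angles a P).

End Patterns.

Section FlowPattern.
Variables (R : realType) (V F : finType) (N : fusion_network R V F).
Variables (p : V + F -> {set V + F}) (lt : rel (V + F)).

(* [ms] lists the measured nodes in the order of execution.  When [lt] is only
   partial, [ms] is one of its linear extensions. *)
Definition in_flow_order (ms : seq V) : Prop :=
  [/\ uniq ms, ms =i ~: fn_out N &
      forall i j, i \in ms -> j \in ms -> lt (inl i) (inl j) ->
      (index i ms < index j ms)%N].

(* The vertices of the register that come after [u] in the execution; outputs
   do, since [index j ms = size ms] for [j \notin ms]. *)
Definition after (ms : seq V) (u : V + F) : {set V} :=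
  match u with
  | inl i => [set j | (index i ms < index j ms)%N]
  | inr _ => setT
  end.

(* The Z part is Odd (p u) cut down to the later vertices, and not the odd
   neighbourhood of the cut-down p u: an X-measured vertex of p u that comes
   before u needs no X, but the Z it induces on its later neighbours must still
   be applied. *)
Definition corrections (ms : seq V) (u : V + F) : pattern R V (V + F)%type :=
  [:: CorrectX [set j in after ms u | inl j \in p u] [set u];
      CorrectZ [set j in after ms u | inl j \in odd_nbhd (target_adj N) (p u)]
        [set u]].

(* The corrections for the fusions follow the last fusion: X on a node does
   not commute with a later fusion of that node, and would flip the effective
   outcome of a later Y-fusion. *)
Definition flow_pattern (ms : seq V) (fs : seq F) : pattern R V (V + F)%type :=
  flatten [seq corrections ms (inl i) ++
             [:: Measure i (fn_label N i) (fn_angle N i) (inl i)]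
          | i <- rev ms] ++
  flatten [seq corrections ms (inr f) | f <- fs] ++
  [seq Fuse (fn_ends N f).1 (fn_ends N f).2 (fn_flabel N f) (inr f)
  | f <- fs] ++
  [seq Entangle uv.1 uv.2 | uv <- edges (fn_adj N)] ++
  [seq Prepare i | i <- enum (~: fn_in N)].

(* The target map acts on the register [V + F]; a state of qubits of [V] is
   read there as one that does not depend on the fusion vertices. *)
Definition extend (psi : state R V) : state R (V + F)%type :=
  [ffun x : {ffun V + F -> bool} => psi [ffun v => x (inl v)]].

Definition implements_target (P : pattern R V (V + F)%type) : Prop :=
  forall k, exists2 c : R[i], c != 0 &
  forall psi, state_on (fn_in N) psi ->
  forall x, extend (success_branch P k psi) x
            = c * target_map (target_graph N) (extend psi) x.

End FlowPattern.

(* Main.v *)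
(* Successful fusions only add vertices to the graph state, so every branch is
   a sequence of bras applied to one graph state on [V + F], followed by Pauli
   corrections.  For a measured vertex [v], the stabilizer X_(p v) Z_(Odd (p v))
   fixes this state up to sign.  On vertices measured before [v], and on fusion
   vertices, the flow conditions make it preserve each measurement vector up to
   a phase; on [v] itself it exchanges the two outcomes; on the remaining
   vertices it is exactly the correction applied by the pattern.  Hence the
   corrections for [v] turn outcome 1 at [v] into outcome 0, up to a phase that
   does not depend on the state, and every branch reduces to the target map. *)
Require Import Defs.
From mathcomp Require Import all_boot all_order all_algebra.
From mathcomp Require Import reals trigo.
From mathcomp Require Import complex.
From mathcomp Require Import ring.

Set Implicit Arguments.
Unset Strict Implicit.
Unset Printing Implicit Defensive.

Import Order.TTheory GRing.Theory Num.Theory.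
Local Open Scope ring_scope.
Local Open Scope complex_scope.

(* X^s Z^t maps the measurement basis of label [l] to itself, up to phases, if
   [admissible l s t], and then exchanges its two vectors iff [flip l s t]. *)
Definition flip (l : mlabel) (s t : bool) : bool :=
  match l with
  | XY | PX => t
  | YZ | PZ => s
  | XZ => s
  | PY => s (+) t
  end.

Definition admissible (l : mlabel) (s t : bool) : bool :=
  match l with
  | XY => ~~ s
  | XZ => s == t
  | YZ => ~~ t
  | PX | PY | PZ => true
  end.

(** * Pauli operators on the measurement bases *)

Section Basis.
Variable R : realType.

Lemma norm_i : `|'i : R[i]| = 1.
Proof. by rewrite normc_def /= expr0n add0r expr1n sqrtr1. Qed.

(** X alone exchanges the Y eigenvectors; X and Z together form the Pauli Y up to a phase and keep
    them. *)
Lemma ket_y_flip t k b :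
  ket_y R k (b (+) true) * (-1) ^+ (t && b) =
  (-1) ^+ k * 'i * ket_y R (k (+) ~~ t) b.
Proof.
rewrite /ket_y; case: b => /=; last by rewrite andbF; ring.
have -> : (-1) ^+ k * 'i * (rsqrt2 R * ((-1) ^+ (k (+) ~~ t) * 'i))
        = rsqrt2 R * (((-1) ^+ k * (-1) ^+ (k (+) ~~ t)) * ('i * 'i)) by ring.
rewrite -signr_addb addbA addbb addFb -expr2 sqr_i andbT signrN.
by ring.
Qed.

(** The left side gives the amplitudes of Z^t X^s, the adjoint of X^s Z^t, on a basis vector. For a
    planar label the admissible Pauli is diagonal in the pair of vectors being superposed, so it
    changes only their relative sign, that is, [k]. *)
Lemma basis_pauli l (a : R) k s t : admissible l s t ->
  exists2 c : R[i], `|c| = 1 & forall b,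
    basis l a k (b (+) s) * (-1) ^+ (t && b) =
    c * basis l a (k (+) flip l s t) b.
Proof.
have norm_sign (b : bool) : `|(-1) ^+ b : R[i]| = 1.
  by rewrite normrX normrN1 expr1n.
case: l => /=.
- move=> /negPf ->; exists 1; rewrite ?normr1 // => b; rewrite signr_addb addbF.
  by case: b; case: t; rewrite /= /ket_z /= ?expr0 ?expr1; ring.
- move=> /eqP <-; case: s; last first.
    by exists 1; rewrite ?normr1 // => b; rewrite !addbF /= expr0; ring.
  have y_flip k' b : ket_y R k' (b (+) true) * (-1) ^+ b = _ :=
    ket_y_flip true k' b.
  exists ((-1) ^+ false * 'i); first by rewrite expr0 mul1r norm_i.
  move=> b; rewrite -mulrA mulrDl -(mulrA _ (ket_y _ _ _)) !y_flip !addbF.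
  by rewrite addbT signrN; ring.
- move=> /negPf ->; exists ((-1) ^+ false); first exact: norm_sign.
  move=> b; rewrite /ket_x signr_addb.
  by case: b; case: s => /=; rewrite ?expr0 ?expr1; ring.
- exists ((-1) ^+ (k && s)); first exact: norm_sign.
  move=> b; rewrite /ket_x.
  by case: b; case: s; case: t; case: k => /=; rewrite ?expr0 ?expr1; ring.
- case: s => _; last first.
    exists 1; rewrite ?normr1 // => b; rewrite addbF /ket_y.
    rewrite /= signr_addb.
    by case: b; case: t => /=; rewrite ?expr0 ?expr1; ring.
  exists ((-1) ^+ k * 'i); first by rewrite normrM norm_sign norm_i mulr1.
  by move=> b; rewrite ket_y_flip.
- exists ((-1) ^+ (t && (k (+) s))); first exact: norm_sign.
  move=> b; rewrite /ket_z.
  by case: b; case: s; case: t; case: k => /=; rewrite ?expr0 ?expr1; ring.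
Qed.

End Basis.

(** * Scalars, Pauli operators and single bras *)

Section Register.
Variables (R : realType) (W : finType).
Implicit Types (psi chi : state R W) (x y : {ffun W -> bool}).
Implicit Types (S T : {set W}) (L : seq W).

Definition scale (c : R[i]) psi : state R W := [ffun x => c * psi x].

Lemma scale1 psi : scale 1 psi = psi.
Proof. by apply/ffunP => x; rewrite ffunE mul1r. Qed.

Lemma scale_scale c d psi : scale c (scale d psi) = scale (c * d) psi.
Proof. by apply/ffunP => x; rewrite !ffunE mulrA. Qed.

Definition pauli S T psi : state R W := pauliX S (pauliZ T psi).

Lemma pauli_scale S T c psi : pauli S T (scale c psi) = scale c (pauli S T psi).
Proof. by apply/ffunP => x; rewrite !ffunE mulrCA. Qed.

Definition upd x w b : {ffun W -> bool} :=
  [ffun j => if j == w then b else x j].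

Lemma bra_scale w v c psi : bra w v (scale c psi) = scale c (bra w v psi).
Proof.
apply/ffunP => x; rewrite !ffunE mulr_sumr.
by apply: eq_bigr => b _; rewrite !ffunE mulrCA.
Qed.

Lemma bra_bra i j v w psi : i != j ->
  bra i v (bra j w psi) = bra j w (bra i v psi).
Proof.
move=> neq_ij; apply/ffunP => x; rewrite !ffunE.
under eq_bigr => b _ do rewrite ffunE mulr_sumr.
rewrite exchange_big; apply: eq_bigr => c _.
rewrite ffunE mulr_sumr; apply: eq_bigr => b _.
rewrite mulrCA; congr (_ * (_ * psi _)); apply/ffunP => u; rewrite !ffunE.
by case: (u =P j) => // ->; rewrite eq_sym (negPf neq_ij).
Qed.

Lemma sign_card_upd T x w b :
  (-1) ^+ #|[set j in T | upd x w b j]| =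
  (-1) ^+ ((w \in T) && b) * (-1) ^+ #|[set j in T :\ w | x j]| :> R[i].
Proof.
rewrite -exprD; congr (_ ^+ _).
have split_w : [set j in T | upd x w b j] =
    [set j in [set w] | (j \in T) && b] :|: [set j in T :\ w | x j].
  apply/setP => j; rewrite !inE !ffunE.
  by case: (j =P w) => [->|_]; rewrite /= ?orbF.
rewrite split_w cardsU (_ : _ :&: _ = set0) ?cards0 ?subn0; last first.
  by apply/setP => j; rewrite !inE; case: (j == w); rewrite ?andbF.
congr (_ + _)%N; case tb: ((w \in T) && b); last first.
  rewrite (_ : [set _ in _ | _] = set0) ?cards0 //.
  by apply/setP => j; rewrite !inE; case: (j =P w) => [->|//]; rewrite tb.
rewrite (_ : [set _ in _ | _] = [set w]) ?cards1 //.
by apply/setP => j; rewrite !inE; case: (j =P w) => [->|//]; rewrite tb.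
Qed.

(** The Pauli factor at [w] moves onto the bra, and the other factors commute with it. The scalar is
    conjugated because a bra is antilinear in its vector. *)
Lemma bra_pauli w (v v' : bool -> R[i]) (c : R[i]) S T psi :
  (forall b, v (b (+) (w \in S)) * (-1) ^+ ((w \in T) && b) = c * v' b) ->
  bra w v (pauli S T psi) = scale c^* (pauli (S :\ w) (T :\ w) (bra w v' psi)).
Proof.
move=> vE; apply/ffunP => x; rewrite !ffunE.
(* Shifting the summed bit undoes the X at [w]. *)
rewrite (reindex_inj (h := addb (w \in S))); last by move=> a b /addbI.
rewrite !mulr_sumr; apply: eq_bigr => b _; rewrite !ffunE.
have -> : [ffun j =>
    [ffun j0 => if j0 == w then (w \in S) (+) b else x j0] j (+) (j \in S)] =
    upd [ffun j => x j (+) (j \in S :\ w)] w b.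
  apply/ffunP => j; rewrite !ffunE !inE.
  by case: (j =P w) => // ->; rewrite addbC addbA addbb.
rewrite sign_card_upd addbC !mulrA; congr (_ * _).
rewrite [RHS]mulrAC -mulrA -rmorphM -vE rmorphM /= rmorph_sign; ring.
Qed.

End Register.

(** * Sequences of measurements *)

Section Measure.
Variables (R : realType) (W : finType) (M : labelled_graph R W).
Implicit Types (psi chi : state R W) (x y : {ffun W -> bool}).
Implicit Types (S T : {set W}) (L : seq W) (k : W -> bool).

Definition measure k L psi : state R W :=
  foldr (fun w => bra w (basis (lg_label M w) (lg_angle M w) (k w))) psi L.

Lemma measure_scale k L c psi :
  measure k L (scale c psi) = scale c (measure k L psi).
Proof. by elim: L => //= w L ->; rewrite bra_scale. Qed.

Lemma eq_measure k k' L psi : {in L, k =1 k'} ->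
  measure k L psi = measure k' L psi.
Proof.
elim: L => //= w L IHL kk'; rewrite kk' ?mem_head // IHL // => u uL.
by apply: kk'; rewrite inE uL orbT.
Qed.

Lemma perm_measure k L1 L2 psi : uniq L1 -> perm_eq L1 L2 ->
  measure k L1 psi = measure k L2 psi.
Proof.
elim: L1 L2 => [|w L1 IHL] L2 /=.
  by move=> _ /perm_size/esym/size0nil ->.
move=> /andP[wL1 uL1] pL.
have wL2 : w \in L2 by rewrite -(perm_mem pL) mem_head.
case/splitPr: wL2 pL => A B; rewrite perm_sym -cat1s perm_catCA /= perm_cons.
rewrite perm_sym => pAB; rewrite (IHL _ uL1 pAB).
have : w \notin A by apply: contra wL1; rewrite (perm_mem pAB) mem_cat => ->.
elim: A {IHL pAB} => //= u A IHA; rewrite inE negb_or => /andP[wu wA].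
by rewrite -IHA // bra_bra.
Qed.

(** Each bra absorbs the Pauli factor at its own qubit, possibly toggling its outcome; the factors
    outside [L] survive. *)
Lemma measure_pauli k L S T : uniq L ->
  {in L, forall w, admissible (lg_label M w) (w \in S) (w \in T)} ->
  exists2 c : R[i], `|c| = 1 & forall psi,
    measure k L (pauli S T psi) = scale c
      (pauli (S :\: [set w in L]) (T :\: [set w in L])
        (measure (fun w => k w (+) flip (lg_label M w) (w \in S) (w \in T))
          L psi)).
Proof.
elim: L => [|w L IHL] /=.
  move=> _ _; exists 1; rewrite ?normr1 // => psi.
  have nil0 : [set w in [::]] = set0 :> {set W}.
    by apply/setP => w; rewrite !inE.
  by rewrite scale1 nil0 !setD0.
move=> /andP[wL uL] adm.
have [u uL'|c nc IH] := IHL uL; first by apply: adm; rewrite inE uL' orbT.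
have [d nd dE] := basis_pauli (lg_angle M w) (k w) (adm w (mem_head _ _)).
exists (c * d^*); first by rewrite normrM norm_conjC nc nd mulr1.
move=> psi; rewrite IH bra_scale.
have DE (Q : {set W}) : Q :\: [set u in w :: L] = (Q :\: [set u in L]) :\ w.
  by apply/setP => u; rewrite !inE negb_or andbA.
have mE (Q : {set W}) : (w \in Q :\: [set u in L]) = (w \in Q).
  by rewrite !inE wL.
rewrite (bra_pauli (v' := basis (lg_label M w) (lg_angle M w)
  (k w (+) flip (lg_label M w) (w \in S) (w \in T))) (c := d)); last first.
  by move=> b; rewrite !mE dE.
by rewrite scale_scale !DE.
Qed.

(** Diagonal operators, used for the CZ gates of fusions: they pass any bra whose coordinate [d]
    ignores. *)
Definition mult (d : {ffun W -> bool} -> R[i]) psi : state R W :=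
  [ffun x => d x * psi x].

Lemma bra_mult w v d psi : (forall x b, d (upd x w b) = d x) ->
  bra w v (mult d psi) = mult d (bra w v psi).
Proof.
move=> dE; apply/ffunP => x; rewrite !ffunE mulr_sumr.
by apply: eq_bigr => b _; rewrite ffunE dE mulrCA.
Qed.

Lemma measure_mult k L d psi : (forall w x b, w \in L -> d (upd x w b) = d x) ->
  measure k L (mult d psi) = mult d (measure k L psi).
Proof.
elim: L => //= w L IHL dE; rewrite IHL => [|u x b uL]; last first.
  by rewrite dE // inE uL orbT.
by rewrite bra_mult // => x b; rewrite dE ?mem_head.
Qed.

End Measure.

(** * Counting edges modulo two *)

Section Edges.
Variables (W : finType) (e : rel W).
Hypotheses (e_sym : symmetric e) (e_irr : irreflexive e).

(** [edges] keeps one orientation of each edge; swapping the pair supplies the other, and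
    irreflexivity excludes equal ranks. *)
Lemma sum_edges (g : W -> W -> nat) :
  (\sum_(uv <- edges e) (g uv.1 uv.2 + g uv.2 uv.1) =
   \sum_u \sum_(v | e u v) g u v)%N.
Proof.
rewrite /edges big_filter enumT pair_big_dep /=.
rewrite big_split /= [X in (_ + X)%N](reindex_inj (h := fun uv => (uv.2, uv.1))) /=;
  last by move=> [a b] [c d] /= [-> ->].
rewrite [RHS](bigID (fun uv => enum_rank uv.1 < enum_rank uv.2)%N) /=.
congr (_ + _)%N; apply: eq_bigl => -[u v] //=.
rewrite e_sym; case uv: (e u v) => //=.
rewrite -leqNgt ltn_neqAle; case: eqP => [/val_inj/enum_rank_inj vu|//].
by rewrite vu e_irr in uv.
Qed.

Definition edge_count (x : W -> bool) : nat :=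
  \sum_(uv <- edges e) (x uv.1 && x uv.2).

(** The doubled count is free of the enumeration order, so edge counts of different graphs become
    comparable. *)
Lemma double_edge_count x :
  (edge_count x).*2 = (\sum_u \sum_(v | e u v) (x u && x v))%N.
Proof.
rewrite -sum_edges -addnn /edge_count -big_split /=.
by apply: eq_bigr => uv _; rewrite andbC.
Qed.

(** Modulo two, [edge_count] is a quadratic form; its polar form pairs [x] with the odd
    neighbourhood of [y]. *)
Lemma odd_edge_count_add x y :
  odd (edge_count (fun u => x u (+) y u)) =
  odd (edge_count x) (+) odd (edge_count y) (+)
    odd #|[set u in odd_nbhd e [set v | y v] | x u]|.
Proof.
have odd_sum (I : Type) (r : seq I) (f : I -> nat) P :
    odd (\sum_(i <- r | P i) f i) = \big[addb/false]_(i <- r | P i) odd (f i).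
  exact: (big_morph odd oddD).
have -> : odd #|[set u in odd_nbhd e [set v | y v] | x u]| =
    odd (\sum_u \sum_(v | e u v) (x u && y v)).
  rewrite -sum1_card big_mkcond !odd_sum; apply: eq_bigr => u _.
  rewrite !inE -sum1_card -big_mkcondr /=.
  case: (x u); last by rewrite andbF big_pred0 // => v; rewrite andbF.
  rewrite andbT (eq_bigl (fun v => e u v && y v)) => [|v]; last first.
    by rewrite !inE andbC.
  by rewrite /=; case: (odd (\sum_(v | e u v && y v) 1)).
rewrite -sum_edges /edge_count !odd_sum -!big_split /=.
apply: eq_bigr => -[u v] _ /=; rewrite oddD.
by case: (x u); case: (x v); case: (y u); case: (y v).
Qed.

End Edges.

(** * Graph states and their stabilizers *)

Section GraphState.
Variables (R : realType) (W : finType) (e : rel W).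
Implicit Types (psi : state R W) (x : {ffun W -> bool}).

Definition graph_state (c : R[i]) psi : state R W :=
  [ffun x : {ffun W -> bool} => c * (-1) ^+ edge_count e x * psi x].

Lemma graph_stateE (A : {set W}) psi :
  foldr (fun uv => cz uv.1 uv.2)
    (foldr (fun i => ket i (ket_x R false)) psi (enum A)) (edges e) =
  graph_state (rsqrt2 R ^+ #|A|) psi.
Proof.
apply/ffunP => x; rewrite ffunE mulrAC mulrC /edge_count.
elim: (edges e) => [|uv r IHr] /=; last first.
  by rewrite ffunE IHr big_cons exprD mulrA.
rewrite big_nil expr0 mul1r cardE; elim: (enum A) => [|i r IHr] /=.
  by rewrite expr0 mul1r.
by rewrite ffunE IHr /ket_x expr0 if_same mulr1 exprS mulrA.
Qed.

(** Shifting the basis label by [K] changes the sign by the polar form of the edge count, which Z on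
    the odd neighbourhood cancels; the sign of the edges inside [K] remains. [psi] is unaffected
    since [K] avoids [A]. *)
Lemma graph_state_stabilizer (A K : {set W}) c psi :
  symmetric e -> irreflexive e -> state_on A psi -> K \subset ~: A ->
  pauli K (odd_nbhd e K) (graph_state c psi) =
  scale ((-1) ^+ edge_count e (mem K)) (graph_state c psi).
Proof.
move=> e_sym e_irr psiA KA; apply/ffunP => x; rewrite !ffunE.
set y := [ffun j => x j (+) (j \in K)].
have -> : psi y = psi x.
  apply: psiA => j jA; rewrite ffunE; have := subsetP KA j; rewrite inE jA.
  by case: (j \in K) => [/(_ isT)|]; rewrite ?addbF.
have xE : edge_count e x = edge_count e (fun u => y u (+) mem K u).
  by apply: eq_bigr => uv _; rewrite !ffunE !addbK.
have signs : (-1) ^+ #|[set j in odd_nbhd e K | y j]| * (-1) ^+ edge_count e y =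
    (-1) ^+ edge_count e (mem K) * (-1) ^+ edge_count e x :> R[i].
  rewrite -!exprD -signr_odd -[RHS]signr_odd !oddD xE.
  rewrite (odd_edge_count_add e_sym e_irr y (mem K)).
  have -> : [set v | mem K v] = K by apply/setP => v; rewrite inE.
  by do 3!case: (odd _).
have mulACA (a b : R[i]) : a * (c * b * psi x) = c * (a * b) * psi x by ring.
by rewrite !mulACA signs.
Qed.

End GraphState.

(** * Embedding node states into the target register *)

Section Extend.
Variables (R : realType) (V F : finType).
Implicit Types (psi : state R V).
Local Notation extend := (@extend R V F).

Lemma extend_inj psi chi : extend psi = extend chi -> psi = chi.
Proof.
move=> /ffunP ext; apply/ffunP => x.
have := ext [ffun w => if w is inl v then x v else false]; rewrite !ffunE.
by congr (psi _ = chi _); apply/ffunP => v; rewrite !ffunE.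
Qed.

Lemma extend_scale c psi : extend (scale c psi) = scale c (extend psi).
Proof. by apply/ffunP => x; rewrite !ffunE. Qed.

Lemma extend_bra i v psi : extend (bra i v psi) = bra (inl i) v (extend psi).
Proof.
apply/ffunP => x; rewrite !ffunE; apply: eq_bigr => b _; rewrite !ffunE.
by congr (_ * psi _); apply/ffunP => j; rewrite !ffunE.
Qed.

Lemma extend_pauli (S T : {set V}) psi :
  extend (pauliX S (pauliZ T psi)) = pauli (inl @: S) (inl @: T) (extend psi).
Proof.
have inl_inj : injective (@inl V F) by move=> a b [].
apply/ffunP => x; rewrite !ffunE; congr (_ ^+ _ * psi _); last first.
  by apply/ffunP => j; rewrite !ffunE (mem_imset _ _ inl_inj).
rewrite -(card_imset _ inl_inj); apply: eq_card => w; rewrite !inE.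
apply/imsetP/andP => [[j]|[/imsetP[j jT ->]]].
  by rewrite !inE !ffunE => /andP[jT xj] ->; rewrite !(mem_imset _ _ inl_inj).
rewrite !ffunE (mem_imset _ _ inl_inj) => xj; exists j => //.
by rewrite !inE !ffunE jT.
Qed.

Lemma extend_state_on (A : {set V}) psi :
  state_on A psi -> state_on (inl @: A) (extend psi).
Proof.
move=> psiA x y xy; rewrite !ffunE; apply: psiA => i iA; rewrite !ffunE.
by apply: xy; apply: imset_f.
Qed.

End Extend.

(** * Fusions as extra vertices of a graph state *)

Section Resource.
Variables (R : realType) (V F : finType) (N : fusion_network R V F).
Implicit Types (psi chi : state R V).
Local Notation W := (V + F)%type.
Let M := target_graph N.
Local Notation ext := (@extend R V F).

Lemma target_adj_sym : symmetric (target_adj N).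
Proof. by case=> [a|f] [b|g] //=; apply: fn_sym. Qed.

Lemma target_adj_irr : irreflexive (target_adj N).
Proof. by case=> [a|f] //=; apply: fn_irr. Qed.

(** Doubling avoids comparing the ranks in [V + F] with those in [V]. The ends of a fusion form a
    set, so fusing a node with itself adds one edge. *)
Lemma target_edge_count (x : W -> bool) :
  edge_count (target_adj N) x =
  (edge_count (fn_adj N) (x \o inl) +
   \sum_f \sum_(u in [set (fn_ends N f).1; (fn_ends N f).2])
     (x (inr f) && x (inl u)))%N.
Proof.
apply: double_inj; rewrite doubleD.
rewrite (double_edge_count target_adj_sym target_adj_irr).
rewrite (double_edge_count (fn_sym N) (fn_irr N)) big_sumType /=.
under eq_bigr => a _ do rewrite big_sumType /=.
under [X in (_ + X)%N = _]eq_bigr => f _ do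
  rewrite big_sumType /= [X in (_ + X)%N]big_pred0 // addn0.
rewrite big_split /= -addnA -addnn; congr (_ + (_ + _))%N.
rewrite (exchange_big_dep xpredT) //=; apply: eq_bigr => f _.
by apply: eq_big => u; rewrite // andbC.
Qed.

Definition fusion_factor (f : F) (x : {ffun W -> bool}) : R[i] :=
  (\prod_(u in [set (fn_ends N f).1; (fn_ends N f).2])
     (-1) ^+ (x (inr f) && x (inl u))) * rsqrt2 R.

Lemma extend_fuse f o chi :
  ext (fuse (fn_ends N f).1 (fn_ends N f).2 (fn_flabel N f) o chi) =
  bra (inr f) (basis (lg_label M (inr f)) (lg_angle M (inr f)) o)
    (mult (fusion_factor f) (ext chi)).
Proof.
apply/ffunP => x; rewrite !ffunE; apply: eq_bigr => b _; rewrite !ffunE.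
congr (_ * _); rewrite /fusion_factor -[RHS]mulrA; congr (_ * (_ * chi _)).
- by apply: eq_bigr => u _; rewrite !ffunE eqxx.
- by rewrite /ket_x expr0 if_same mulr1.
- by apply/ffunP => v; rewrite !ffunE.
Qed.

(** A fusion factor reads no fusion coordinate but its own, so all factors can be applied before all
    bras. *)
Lemma extend_fuses (k : W -> bool) fs chi : uniq fs ->
  ext (foldr (fun f => fuse (fn_ends N f).1 (fn_ends N f).2 (fn_flabel N f)
                         (k (inr f))) chi fs) =
  measure M k (map inr fs)
    (mult (fun x => \prod_(f <- fs) fusion_factor f x) (ext chi)).
Proof.
elim: fs => [|f fs IHfs] /=.
  by move=> _; apply/ffunP => x; rewrite !ffunE big_nil mul1r.
move=> /andP[ffs ufs]; rewrite extend_fuse IHfs //= -measure_mult.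
  congr (bra _ _ (measure _ _ _ _)); apply/ffunP => x.
  by rewrite !ffunE big_cons mulrA.
move=> w x b /mapP[g gfs ->]; rewrite /fusion_factor; congr (_ * _).
apply: eq_bigr => u _; rewrite !ffunE /=.
by case: eqP => // -[fg]; rewrite fg gfs in ffs.
Qed.

Definition resource psi : state R W :=
  graph_state (target_adj N) (rsqrt2 R ^+ #|~: lg_in M|) (ext psi).

Lemma card_target_prepared : #|~: lg_in M| = (#|~: fn_in N| + #|F|)%N.
Proof.
have inl_inj : injective (@inl V F) by move=> a b [].
apply: (@addnI #|lg_in M|); rewrite cardsC card_imset //.
by rewrite addnA cardsC card_sum.
Qed.

Lemma target_mapE psi :
  target_map M (ext psi) =
  measure M (fun=> false) (enum (~: lg_out M)) (resource psi).
Proof. by rewrite /target_map graph_stateE. Qed.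

(** The collected factors supply the missing edges and, one per fusion vertex, the missing powers of
    [rsqrt2]. *)
Lemma extend_fused_graph k fs psi : perm_eq fs (enum F) ->
  ext (foldr (fun f => fuse (fn_ends N f).1 (fn_ends N f).2 (fn_flabel N f)
                         (k (inr f)))
        (graph_state (fn_adj N) (rsqrt2 R ^+ #|~: fn_in N|) psi) fs) =
  measure M k (map inr fs) (resource psi).
Proof.
move=> pfs; rewrite extend_fuses; last by rewrite (perm_uniq pfs) enum_uniq.
congr (measure _ _ _ _); apply/ffunP => x; rewrite !ffunE.
rewrite (perm_big _ pfs) /= big_enum /= /fusion_factor big_split /=.
rewrite prodr_const target_edge_count exprD card_target_prepared exprD.
have -> : edge_count (fn_adj N) (x \o inl) =
    edge_count (fn_adj N) [ffun v => x (inl v)].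
  by apply: eq_bigr => uv _; rewrite !ffunE.
rewrite [X in _ = _ * (_ * X) * _](_ : _ = \prod_f
  \prod_(u in [set (fn_ends N f).1; (fn_ends N f).2])
    (-1) ^+ (x (inr f) && x (inl u))).
  by ring.
by rewrite expr_sum; apply: eq_bigr => f _; rewrite expr_sum.
Qed.

End Resource.

(** * Branches of the flow pattern *)

Section Flow.
Variables (R : realType) (V F : finType) (N : fusion_network R V F).
Variables (p : V + F -> {set V + F}) (lt : rel (V + F)).
Variables (ms : seq V) (fs : seq F).
Hypotheses (flow : xy_flow N p lt) (order : in_flow_order N lt ms).
Hypothesis enum_fs : perm_eq fs (enum F).
Implicit Types (psi : state R V) (u v w : V + F) (k : V + F -> bool).
Local Notation W := (V + F)%type.
Local Notation M := (target_graph N).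
Local Notation ext := (@extend R V F).
Local Notation Odd := (odd_nbhd (target_adj N)).

(* The stabilizer attached to [v] preserves the measurement basis at [w], and
   exchanges its two vectors iff [b]. *)
Definition acts_as (b : bool) v w : bool :=
  admissible (lg_label M w) (w \in p v) (w \in Odd (p v)) &&
  (flip (lg_label M w) (w \in p v) (w \in Odd (p v)) == b).

(** Flow conditions (4) to (9) are, label by label, the requirements of [acts_as true]. *)
Lemma acts_as_self v : v \notin lg_out M -> acts_as true v v.
Proof.
case: flow => pf _ _ vO; rewrite /acts_as.
case lv: (lg_label M v) => /=.
- by have [/negPf -> ->] := pf_4 pf vO lv.
- by have [-> ->] := pf_5 pf vO lv.
- by have [-> /negPf ->] := pf_6 pf vO lv.
- by rewrite (pf_7 pf vO lv).
- by rewrite (pf_9 pf vO lv).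
- by rewrite (pf_8 pf vO lv).
Qed.

(** The XY-flow conditions give this irrespective of [lt], which allows all fusions to be performed
    first. *)
Lemma acts_as_fusion v f : v \notin lg_out M -> v != inr f ->
  acts_as false v (inr f).
Proof.
case: flow => _ fX fY vO vf; rewrite /acts_as /=.
case lf: (fn_flabel N f) => /=; first by rewrite (negPf (fX _ _ lf vO vf)).
by rewrite (fY _ _ lf vO vf) addbb.
Qed.

(** By contraposition (1) and (2) forbid X, respectively Z, at [w] unless its label tolerates it;
    (3) balances them on a Y-measured vertex. *)
Lemma acts_as_past v w : v \notin lg_out M -> w \notin lg_out M -> v != w ->
  ~~ lt v w -> acts_as false v w.
Proof.
case: flow => pf _ _ vO wO vw ltvw.
have noX : ~~ (is_PX (lg_label M w) || is_PY (lg_label M w)) -> w \notin p v.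
  move=> l; apply: contra ltvw => wp.
  by apply: (pf_1 pf vO wp _ vw); rewrite l orbT.
have noZ : ~~ (is_PY (lg_label M w) || is_PZ (lg_label M w)) ->
    w \notin Odd (p v).
  move=> l; apply: contra ltvw => wp.
  by apply: (pf_2 pf vO wp _ vw); rewrite l orbT.
have Y := pf_3 pf vO wO ltvw _ vw.
rewrite /acts_as; case: (lg_label M w) noX noZ Y => /= noX noZ Y;
  do ?[rewrite (negPf (noX isT)) | rewrite (negPf (noZ isT))] => //.
by rewrite Y // addbb.
Qed.

(** The resource state, up to sign, is replaced by the stabilizer of [v] applied to it; pushed
    through the bras, this toggles the outcome at [v] and leaves a correction outside [L]. *)
Lemma measure_resource v k L : v \notin lg_out M -> uniq L ->
  {in L, forall w, acts_as (w == v) v w} ->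
  exists2 c : R[i], `|c| = 1 & forall psi, state_on (fn_in N) psi ->
    pauli (p v :\: [set w in L]) (Odd (p v) :\: [set w in L])
      (measure M k L (resource N psi)) =
    scale c (measure M (fun w => k w (+) (w == v)) L (resource N psi)).
Proof.
move=> vO uL act.
(* The outcome at [v] is toggled beforehand, so that the flip restores [k]. *)
have [w wL|c nc cE] := @measure_pauli _ _ M (fun w => k w (+) (w == v)) L
  (p v) (Odd (p v)) uL; first by case/andP: (act w wL).
have c0 : c != 0 by rewrite -normr_eq0 nc oner_eq0.
have norm_sign n : `|(-1) ^+ n : R[i]| = 1 by rewrite normrX normrN1 expr1n.
exists (c^-1 * (-1) ^+ edge_count (target_adj N) (mem (p v))).
  by rewrite normrM normfV nc norm_sign invr1 mulr1.
move=> psi psiI; rewrite -scale_scale -measure_scale.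
rewrite -(@graph_state_stabilizer R _ (target_adj N) (lg_in M)); first last.
- exact: (pf_codom (xy_pauli flow)).
- exact: extend_state_on.
- exact: target_adj_irr.
- exact: target_adj_sym.
rewrite cE scale_scale mulVf // scale1; congr (pauli _ _ _).
apply: eq_measure => w wL; case/andP: (act w wL) => _ /eqP ->.
by rewrite -addbA addbb addbF.
Qed.

Definition measured_qubits (s : seq V) : seq (V + F) := map inl s ++ map inr fs.

Lemma extend_corrections k v psi (P : pattern R V W) :
  ext (success_branch (corrections N p ms v ++ P) k psi) =
  if k v then
    pauli (inl @: [set j in after ms v | inl j \in p v])
      (inl @: [set j in after ms v | inl j \in Odd (p v)])
      (ext (success_branch P k psi))
  else ext (success_branch P k psi).
Proof.
have sig : signal k [set v] = k v.
  rewrite /signal; case kv: (k v).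
    rewrite (_ : [set a in _ | _] = [set v]) ?cards1 //.
    by apply/setP => a; rewrite !inE; case: eqP => // ->.
  rewrite (_ : [set a in _ | _] = set0) ?cards0 //.
  by apply/setP => a; rewrite !inE; case: eqP => // ->.
by rewrite /success_branch /= !sig; case: (k v) => //; rewrite extend_pauli.
Qed.

(** Identifies the set corrected by the pattern with the part of the stabilizer's support outside
    the measured qubits. *)
Lemma imset_inl (A : {set V}) (S : {set V + F}) (L : seq (V + F)) :
  (forall j, (j \in A) = (inl j \notin L)) -> (forall f, inr f \in L) ->
  inl @: [set j in A | inl j \in S] = S :\: [set w in L].
Proof.
move=> AL FL; have inl_inj : injective (@inl V F) by move=> a b [].
apply/setP => -[j|f]; rewrite !inE; first by rewrite mem_imset // !inE AL.
by rewrite FL; apply/imsetP => -[].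
Qed.

Lemma mem_fs f : f \in fs.
Proof. by rewrite (perm_mem enum_fs) mem_enum. Qed.

Lemma uniq_fs : uniq fs.
Proof. by rewrite (perm_uniq enum_fs) enum_uniq. Qed.

Let inl_inj : injective (@inl V F). Proof. by move=> a b []. Qed.
Let inr_inj : injective (@inr V F). Proof. by move=> a b []. Qed.

Lemma uniq_measured_qubits s : uniq s -> uniq (measured_qubits s).
Proof.
move=> us; rewrite cat_uniq !map_inj_uniq // us uniq_fs andbT /=.
by apply/hasPn => w /mapP[f _ ->]; apply/mapP => -[].
Qed.

Lemma mem_measured_inl s j : (inl j \in measured_qubits s) = (j \in s).
Proof.
rewrite mem_cat mem_map // orbC; case: (boolP (_ \in map inr _)) => //.
by case/mapP.
Qed.

Lemma mem_measured_inr s f : inr f \in measured_qubits s.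
Proof. by rewrite mem_cat [X in _ || X]mem_map // mem_fs orbT. Qed.

Definition graph_commands : pattern R V W :=
  [seq Entangle uv.1 uv.2 | uv <- edges (fn_adj N)] ++
  [seq Prepare i | i <- enum (~: fn_in N)].

Definition fusion_commands : pattern R V W :=
  [seq Fuse (fn_ends N f).1 (fn_ends N f).2 (fn_flabel N f) (inr f)
  | f <- fs] ++
  graph_commands.

(** All fusions are performed, but only those of [gs] are corrected; this gives an induction on
    [gs]. *)
Definition corrected_fusions (gs : seq F) : pattern R V W :=
  flatten [seq corrections N p ms (inr f) | f <- gs] ++ fusion_commands.

Definition measured_after (s : seq V) : pattern R V W :=
  flatten [seq corrections N p ms (inl i) ++
             [:: Measure i (fn_label N i) (fn_angle N i) (inl i)] | i <- s] ++
  corrected_fusions fs.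

Lemma flow_patternE : flow_pattern N p ms fs = measured_after (rev ms).
Proof. by []. Qed.

Lemma extend_fusion_commands k psi :
  ext (success_branch fusion_commands k psi) =
  measure M k (map inr fs) (resource N psi).
Proof.
rewrite -extend_fused_graph // /success_branch /fusion_commands /graph_commands.
by rewrite !foldr_cat !foldr_map -graph_stateE.
Qed.

(** Each block resets the outcome of its own fusion to 0 and, by [acts_as_fusion], keeps the
    others. *)
Lemma extend_corrected_fusions k gs : uniq gs ->
  exists2 c : R[i], `|c| = 1 & forall psi, state_on (fn_in N) psi ->
    ext (success_branch (corrected_fusions gs) k psi) =
    scale c (measure M (fun w => k w && (w \notin map inr gs)) (map inr fs)
      (resource N psi)).
Proof.
elim: gs => [|g gs IHgs] /=.
  move=> _; exists 1; rewrite ?normr1 // => psi _.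
  rewrite scale1 extend_fusion_commands.
  by apply: eq_measure => w _; rewrite andbT.
move=> /andP[ggs ugs]; have [c nc cE] := IHgs ugs.
have gO : inr g \notin lg_out M by apply/imsetP => -[].
have [||d nd dE] := @measure_resource (inr g)
    (fun w => k w && (w \notin map inr gs)) (map inr fs) gO.
- by rewrite map_inj_uniq // uniq_fs.
- move=> w /mapP[f _ ->]; case: eqP => [->|/eqP fg]; first exact: acts_as_self.
  by apply: acts_as_fusion; rewrite // eq_sym.
case kg: (k (inr g)); last first.
  exists c => // psi psiI.
  rewrite /corrected_fusions /= extend_corrections kg cE //.
  congr (scale _ _); apply: eq_measure => w _; rewrite inE negb_or.
  by case: eqP => // ->; rewrite kg.
exists (c * d); first by rewrite normrM nc nd mulr1.
move=> psi psiI; rewrite /corrected_fusions /= extend_corrections kg cE //.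
rewrite !(@imset_inl _ _ (map inr fs)); first last.
- by move=> f; rewrite mem_map // mem_fs.
- by move=> j; rewrite inE; apply/esym/mapP => -[].
- by move=> f; rewrite mem_map // mem_fs.
- by move=> j; rewrite inE; apply/esym/mapP => -[].
rewrite pauli_scale dE // scale_scale; congr (scale _ _).
apply: eq_measure => w _; rewrite inE negb_or.
case: eqP => [->|_]; last by rewrite addbF.
by rewrite kg mem_map // (negPf ggs).
Qed.

(** [rev ms] lists the latest measurement first, so [i :: s] is what is measured up to [i]; outputs
    count as later, their index being [size ms]. *)
Lemma after_suffix s2 i s : rev ms = s2 ++ i :: s ->
  forall j, (j \in after ms (inl i : W)) = (j \notin i :: s).
Proof.
case: order => ums _ _ msE j.
have {}msE : ms = rev s ++ i :: rev s2.
  by rewrite -[ms]revK msE rev_cat rev_cons cat_rcons.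
have := ums; rewrite msE cat_uniq /= => /and4P[us /norP[si _] _ _].
rewrite !inE !index_cat mem_rev in si *.
rewrite (negPf si) mem_rev /= eqxx addn0.
case: ifP => [js|_].
  by rewrite orbT ltnNge index_size.
rewrite orbF eq_sym; case: eqP => _; rewrite ?addn0 ?ltnn //.
by rewrite addnS ltnS leq_addr.
Qed.

(** Induction on the measured nodes: all earlier outcomes being reset, only the one at [i] can be 1,
    and the corrections for [i] reset it. *)
Lemma extend_measured_after k s2 s : rev ms = s2 ++ s ->
  exists2 c : R[i], `|c| = 1 & forall psi, state_on (fn_in N) psi ->
    ext (success_branch (measured_after s) k psi) =
    scale c (measure M (fun=> false) (measured_qubits s) (resource N psi)).
Proof.
elim: s s2 => [|i s IHs] s2 msE.
  have [c nc cE] := extend_corrected_fusions k uniq_fs.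
  exists c => // psi psiI; rewrite cE //; congr (scale _ _).
  by apply: eq_measure => w ->; rewrite andbF.
have [|c nc cE] := IHs (rcons s2 i); first by rewrite cat_rcons.
case: (order) => ums msO lt_ms.
have sub_ms j : j \in i :: s -> j \in ms.
  by move=> js; rewrite -mem_rev msE mem_cat js orbT.
have out j : j \in i :: s -> inl j \notin lg_out M.
  move=> /sub_ms; rewrite msO inE => jO.
  by apply: contra jO => /imsetP[j' jO [->]].
have us : uniq (i :: s).
  by have := ums; rewrite -rev_uniq msE cat_uniq => /and3P[].
have iO := out i (mem_head _ _).
have [||d nd dE] := @measure_resource (inl i) (fun w => k w && (w == inl i))
    (measured_qubits (i :: s)) iO.
- exact: uniq_measured_qubits.
- case=> [j|f]; last by move=> _; exact: acts_as_fusion.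
  rewrite mem_measured_inl => js.
  case: eqP => [->|/eqP ij]; first exact: acts_as_self.
  apply: acts_as_past => //; [exact: out|by rewrite eq_sym|].
  (* As [ms] extends [lt], a node of [i :: s], not being placed after [i], cannot lie above it. *)
  have := after_suffix msE j; rewrite js inE => /negbT; apply: contra.
  by apply: lt_ms; apply: sub_ms; rewrite ?mem_head.
have bodyE psi : state_on (fn_in N) psi ->
    ext (success_branch (Measure i (fn_label N i) (fn_angle N i) (inl i) ::
      measured_after s) k psi) =
    scale c (measure M (fun w => k w && (w == inl i)) (measured_qubits (i :: s))
      (resource N psi)).
  move=> psiI; rewrite /= extend_bra -/(success_branch _ _ _) cE //.
  rewrite bra_scale eqxx andbT.
  congr (scale _ (bra _ _ _)); apply: eq_measure => w wL /=.
  case: eqP => [wi|_]; last by rewrite andbF.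
  by rewrite wi mem_measured_inl in wL; case/andP: us; rewrite wL.
have blockE : measured_after (i :: s) =
    corrections N p ms (inl i) ++
    Measure i (fn_label N i) (fn_angle N i) (inl i) :: measured_after s by [].
case ki: (k (inl i)); last first.
  exists c => // psi psiI; rewrite blockE extend_corrections ki bodyE //.
  congr (scale _ _); apply: eq_measure => w _.
  by case: eqP => [->|]; rewrite ?ki ?andbF.
exists (c * d); first by rewrite normrM nc nd mulr1.
move=> psi psiI; rewrite blockE extend_corrections ki bodyE //.
have afterE j : (j \in after ms (inl i : W)) =
    (inl j \notin measured_qubits (i :: s)).
  by rewrite (after_suffix msE) mem_measured_inl.
rewrite !(imset_inl _ afterE (mem_measured_inr _)) pauli_scale dE //.
rewrite scale_scale.
congr (scale _ _); apply: eq_measure => w _.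
by case: eqP => [->|]; rewrite ?ki ?andbF.
Qed.

(** Both branches are unit multiples of the all-zero one. The suffix form serves the whole pattern
    and its truncations. *)
Lemma measured_after_deterministic s2 s : rev ms = s2 ++ s ->
  strongly_deterministic (fn_in N) (measured_after s).
Proof.
move=> msE k k'; have [c nc cE] := extend_measured_after k msE.
have [d nd dE] := extend_measured_after k' msE.
have d0 : d != 0 by rewrite -normr_eq0 nd oner_eq0.
exists (c / d); first by rewrite normrM normfV nc nd invr1 mulr1.
move=> psi psiI x.
have -> : success_branch (measured_after s) k psi =
    scale (c / d) (success_branch (measured_after s) k' psi).
  apply: (@extend_inj _ _ F).
  by rewrite extend_scale cE // dE // scale_scale divfK.
by rewrite ffunE.
Qed.

(** After all of [ms], the measured qubits are exactly the non-outputs of the target graph, and the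
    bras commute into the order of [target_map]. *)
Lemma flow_pattern_target : implements_target N (flow_pattern N p ms fs).
Proof.
move=> k; have [c nc cE] := @extend_measured_after k [::] (rev ms) erefl.
exists c; first by rewrite -normr_eq0 nc oner_eq0.
move=> psi psiI x; rewrite flow_patternE cE // ffunE target_mapE.
case: order => ums msO _.
rewrite (@perm_measure _ _ M _ _ (enum (~: lg_out M))) //.
  by rewrite uniq_measured_qubits ?rev_uniq.
apply: uniq_perm => [||[j|f]];
  rewrite ?enum_uniq ?uniq_measured_qubits ?rev_uniq //.
  by rewrite mem_measured_inl mem_rev msO mem_enum !inE mem_imset.
by rewrite mem_measured_inr mem_enum inE; apply/esym/imsetP => -[].
Qed.

Definition is_measure (c : command R V W) : bool :=
  if c is Measure _ _ _ _ then true else false.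

Lemma corrected_fusions_no_measure gs :
  has is_measure (corrected_fusions gs) = false.
Proof.
have no_map (T : Type) (h : T -> command R V W) r :
    (forall t, is_measure (h t) = false) -> has is_measure (map h r) = false.
  by move=> hE; elim: r => //= t r ->; rewrite hE.
by elim: gs => //=; rewrite !has_cat !no_map.
Qed.

(** The fusion stage contains no [Measure], so a split at one falls at the end of the block of some
    node. *)
Lemma measured_after_split s P2 i l a n P1 :
  measured_after s = P2 ++ Measure i l a n :: P1 ->
  exists s2 s1, [/\ s = s2 ++ i :: s1, n = inl i,
    P2 = flatten [seq corrections N p ms (inl j) ++
             [:: Measure j (fn_label N j) (fn_angle N j) (inl j)] | j <- s2] ++
         corrections N p ms (inl i) &
    Measure i l a n :: P1 =
      Measure i (fn_label N i) (fn_angle N i) (inl i) :: measured_after s1].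
Proof.
elim: s P2 => [|j s IHs] P2.
  move=> /(congr1 (has is_measure)).
  by rewrite corrected_fusions_no_measure has_cat /= orbT.
(* A block has three commands, the third a [Measure]: a prefix of two stops in the first block, a
   longer one passes it. *)
case: P2 => [|c1 [|c2 [|c3 P2]]] //=.
  by case=> <- <- <- <- <- <- <-; exists [::], s; split.
case=> <- <- <- /IHs[s2 [s1 [-> -> -> E]]].
by exists (j :: s2), s1; split.
Qed.

End Flow.

(** * Stepwise determinism *)

Section Stepwise.
Variables (R : realType) (V F : finType) (N : fusion_network R V F).
Variables (p : V + F -> {set V + F}) (lt : rel (V + F)).
Variables (ms : seq V) (fs : seq F).
Hypotheses (flow : xy_flow N p lt) (order : in_flow_order N lt ms).
Hypothesis enum_fs : perm_eq fs (enum F).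

(** Every correction depends on the outcome of a single vertex, so only the block for [i] passes the
    filter. *)
Lemma filter_corrections i s : i \notin s ->
  filter (correction_on (inl i))
    (flatten [seq corrections N p ms (inl j) ++
       [:: Measure j (fn_label N j) (fn_angle N j) (inl j)] | j <- s] ++
     corrections N p ms (inl i)) = corrections N p ms (inl i).
Proof.
elim: s => [|j s IHs] /=; first by rewrite inE eqxx.
rewrite inE negb_or => /andP[ij /IHs {}IHs].
by rewrite !inE; case: eqP => [[ji]|_ //]; rewrite ji eqxx in ij.
Qed.

(** Restoring the corrections for [i] turns the truncation into [measured_after (i :: s1)], already
    known to be deterministic. *)
Lemma flow_pattern_stepwise :
  stepwise_deterministic (fn_in N) (flow_pattern N p ms fs).
Proof.
move=> P2 i l a n P1; rewrite flow_patternE => /measured_after_split.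
case=> [s2 [s1 [msE -> -> ->]]].
have uniq_ms : uniq (s2 ++ i :: s1).
  by rewrite -msE rev_uniq; case: order.
rewrite filter_corrections; last first.
  by move: uniq_ms; rewrite cat_uniq => /and3P[_ /norP[]].
move=> k k'.
have [c nc cE] := measured_after_deterministic flow order enum_fs msE k k'.
by exists c; first by rewrite -normr_eq0 nc oner_eq0.
Qed.

End Stepwise.

(** * Changing the measurement angles *)

Section Uniform.
Variables (R : realType) (V F : finType) (N : fusion_network R V F).
Variables (a : V -> R) (a_range : angle_choice (~: fn_out N) a).

(** Flow conditions do not mention angles, so uniformity follows by running the argument on this
    network. *)
Definition reangle : fusion_network R V F :=
  @FusionNetwork R V F (fn_adj N) (fn_in N) (fn_out N) (fn_ends N) (fn_label N)
    (fn_flabel N) a (@fn_sym _ _ _ N) (@fn_irr _ _ _ N)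
    (@fn_ends_measured _ _ _ N) a_range.

Lemma xy_flow_reangle p lt : xy_flow N p lt -> xy_flow reangle p lt.
Proof. by case=> -[? ? ? ? ? ? ? ? ? ? ? ?] ? ?; split=> //; split. Qed.

Lemma with_angles_flow_pattern p ms fs :
  with_angles a (flow_pattern N p ms fs) = flow_pattern reangle p ms fs.
Proof.
rewrite /with_angles /flow_pattern !map_cat !map_flatten -!map_comp.
by congr (_ ++ _).
Qed.

End Uniform.

Close Scope complex_scope.
Close Scope ring_scope.

Theorem theorem4p15 (R : realType) (V F : finType) (N : fusion_network R V F)
    (p : V + F -> {set V + F}) (lt : rel (V + F))
    (ms : seq V) (fs : seq F) :
  xy_flow N p lt ->
  in_flow_order N lt ms ->
  perm_eq fs (enum F) ->
  [/\ uniformly (~: fn_out N) (strongly_deterministic (fn_in N))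
        (flow_pattern N p ms fs),
      uniformly (~: fn_out N) (stepwise_deterministic (fn_in N))
        (flow_pattern N p ms fs) &
      implements_target N (flow_pattern N p ms fs)].
Proof.
move=> flow order enum_fs; split.
- move=> a a_range; rewrite (with_angles_flow_pattern a_range).
  (* With [s2] empty, the suffix is all of [rev ms]. *)
  exact: (measured_after_deterministic (xy_flow_reangle a_range flow) order
    enum_fs (s2 := [::]) erefl).
- move=> a a_range; rewrite (with_angles_flow_pattern a_range).
  exact: (flow_pattern_stepwise (xy_flow_reangle a_range flow) order enum_fs).
- exact: flow_pattern_target flow order enum_fs.
Qed.
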